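(* Let $R=(r_1,\ldots,r_m)$, $C=(c_1,\ldots,c_n)$ be vectors of positive integers with $\sum_ir_i=\sum_jc_j$, $0<r_i<n$, $0<c_j<m$, such that the polytope $\mathcal{P}(R,C)$ of real $m\times n$ matrices with row sums $R$, column sums $C$ and entries in $[0,1]$ contains a matrix with all entries strictly between $0$ and $1$. Let $Z=(z_{ij})$ be the maximum entropy matrix, i.e., the unique maximizer on $\mathcal{P}(R,C)$ of $H(X)=\sum_{i,j}\big(x_{ij}\ln\frac1{x_{ij}}+(1-x_{ij})\ln\frac1{1-x_{ij}}\big)$. Let $X=(x_{ij})$ be a random $m\times n$ matrix of independent Bernoulli random variables with $\Pr\{x_{ij}=1\}=z_{ij}$ and $\Pr\{x_{ij}=0\}=1-z_{ij}$. Then the probability mass function of $X$ is constant on the set $\Sigma(R,C)$ of $m\times n$ 0-1 matrices with row sums $R$ and column sums $C$; moreover $\Pr\{X=D\}=e^{-H(Z)}$ for all $D\in\Sigma(R,C)$.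
   Context: The convention $0\ln\frac10=0$ is used in $H$. *)

(* Defs.v *)
From HB Require Import structures.
From mathcomp Require Export all_boot all_order all_algebra.
From mathcomp Require Export all_classical all_reals all_analysis.

Set Implicit Arguments.
Unset Strict Implicit.
Unset Printing Implicit Defensive.

Import Order.TTheory GRing.Theory Num.Theory.

Local Open Scope classical_set_scope.
Local Open Scope ring_scope.

Section Matrices.
Context {R : realType} {m n : nat}.

Definition margins (r : 'I_m -> nat) (c : 'I_n -> nat) (X : 'M[R]_(m, n)) : Prop :=
  (forall i, \sum_(j < n) X i j = (r i)%:R) /\
  (forall j, \sum_(i < m) X i j = (c j)%:R).

Definition polytope (r : 'I_m -> nat) (c : 'I_n -> nat) : set 'M[R]_(m, n) :=
  [set X | margins r c X /\ forall i j, 0 <= X i j <= 1].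

Definition zero_one_matrices (r : 'I_m -> nat) (c : 'I_n -> nat) :
    set 'M[R]_(m, n) :=
  [set D | margins r c D /\ forall i j, D i j = 0 \/ D i j = 1].

(* The convention 0 ln (1/0) = 0 holds because the factor in front of ln is 0
   and ln is total. *)
Definition entropy (X : 'M[R]_(m, n)) : R :=
  \sum_(i < m) \sum_(j < n)
    (X i j * ln (1 / X i j) + (1 - X i j) * ln (1 / (1 - X i j))).

(* Uniqueness of the maximizer is a consequence of the strict concavity of the
   entropy, so it is not part of the definition. *)
Definition max_entropy_matrix (r : 'I_m -> nat) (c : 'I_n -> nat)
    (Z : 'M[R]_(m, n)) : Prop :=
  polytope r c Z /\ forall Y, polytope r c Y -> entropy Y <= entropy Z.

End Matrices.

Section Probability.
Context {d : measure_display} {T : measurableType d} {R : realType}.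

Definition mutually_independent (P : probability T R) (I : finType)
    (X : I -> {RV P >-> R}) : Prop :=
  forall (J : {set I}) (B : I -> set R),
    (forall i, i \in J -> measurable (B i)) ->
    P (\bigcap_(i in [set` J]) (X i @^-1` B i)) =
    (\prod_(i in J) P (X i @^-1` B i))%E.

Definition random_matrix (P : probability T R) (m n : nat)
    (X : 'I_m -> 'I_n -> {RV P >-> R}) (w : T) : 'M[R]_(m, n) :=
  \matrix_(i, j) X i j w.

Definition matrix_pmf (P : probability T R) (m n : nat)
    (X : 'I_m -> 'I_n -> {RV P >-> R}) (D : 'M[R]_(m, n)) : \bar R :=
  P [set w | random_matrix X w = D].

End Probability.

(* Main.v *)
(** The probability of a 0-1 matrix [D] is the exponential of
    [\sum (D ln Z + (1 - D) ln (1 - Z))], which exceeds [- entropy Z] by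
    [- \sum (D - Z) (ln (1 - Z) - ln Z)], i.e. by minus the derivative of the
    entropy at [Z] in the direction [D - Z].  That direction preserves the
    margins, so the derivative vanishes at the maximizer, as soon as [Z] is
    interior.  It is: moving from [Z] towards an interior point of the polytope,
    the slope of the entropy would be infinite at an entry equal to 0 or 1, and
    bounded below at every other entry. *)
Require Import Defs.
From mathcomp Require Import ring lra.
Set Implicit Arguments.
Unset Strict Implicit.
Unset Printing Implicit Defensive.
Import Order.TTheory GRing.Theory Num.Theory.
Import numFieldNormedType.Exports.
Local Open Scope classical_set_scope.
Local Open Scope ring_scope.

(** * Concavity of the entropy of a single entry, and its slope near 0 and 1 *)

Section BinaryEntropy.
Context {R : realType}.
Implicit Types x y z t K : R.

Definition binary_entropy x : R := x * ln (1 / x) + (1 - x) * ln (1 / (1 - x)).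

(** This is the derivative of [binary_entropy] on the open unit interval. *)
Definition binary_entropy_slope x : R := ln (1 - x) - ln x.

(** For positive [z] this is [ln u <= u - 1] at [u = x / z], multiplied by [z]. *)
Lemma mul_ln_ratio_le x z : 0 < x -> 0 <= z -> z * ln (1 / z) + z * ln x <= x - z.
Proof.
move=> x0; rewrite le_eqVlt => /predU1P[<-|z0]; first by rewrite !mul0r addr0 subr0 ltW.
have xz0 : 0 < x / z by rewrite divr_gt0.
have h : ln x - ln z <= x / z - 1.
  rewrite -ln_div ?posrE // -[in leLHS](subrKC 1 (x / z)) le_ln1Dx //; lra.
rewrite div1r lnV ?posrE // -mulrDr addrC.
apply: le_trans (_ : z * (x / z - 1) <= _); first by rewrite ler_pM2l.
by rewrite mulrBr mulr1 mulrCA divff ?mulr1 // gt_eqF.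
Qed.

Lemma binary_entropyE x : 0 < x < 1 ->
  binary_entropy x = - (x * ln x) - (1 - x) * ln (1 - x).
Proof.
move=> /andP[x0 x1]; rewrite /binary_entropy !div1r !lnV ?posrE ?subr_gt0 //.
by rewrite !mulrN.
Qed.

(** Concavity, with the tangent taken at [x], so that [z] may be an endpoint. Adding
    [mul_ln_ratio_le] for [x, z] and for [1 - x, 1 - z] cancels the right-hand sides. *)
Lemma binary_entropy_tangent x z : 0 < x < 1 -> 0 <= z <= 1 ->
  (x - z) * binary_entropy_slope x <= binary_entropy x - binary_entropy z.
Proof.
move=> x01 /andP[z0 z1]; rewrite (binary_entropyE x01).
move: x01 => /andP[x0 x1].
have h1 := mul_ln_ratio_le x0 z0.
have h2 : (1 - z) * ln (1 / (1 - z)) + (1 - z) * ln (1 - x) <= (1 - x) - (1 - z).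
  by apply: mul_ln_ratio_le; rewrite ?subr_gt0 ?subr_ge0.
by rewrite /binary_entropy /binary_entropy_slope; lra.
Qed.

Lemma binary_entropy_slopeN x : binary_entropy_slope (1 - x) = - binary_entropy_slope x.
Proof. by rewrite /binary_entropy_slope subKr opprB. Qed.

Lemma binary_entropy_slope_decr x y : 0 < x -> x <= y -> y < 1 ->
  binary_entropy_slope y <= binary_entropy_slope x.
Proof.
move=> x0 xy y1; rewrite /binary_entropy_slope lerB // ler_ln ?posrE; lra.
Qed.

(** The slope is minus the logit, so a logistic function inverts it; this provides explicit points
    of any prescribed slope. *)
Lemma binary_entropy_slope_logistic K : binary_entropy_slope (1 + expR K)^-1 = K.
Proof.
have e0 : 0 < 1 + expR K by rewrite addr_gt0 ?expR_gt0.
have -> : binary_entropy_slope (1 + expR K)^-1 =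
    ln (expR K / (1 + expR K)) - ln (1 + expR K)^-1.
  by congr (ln _ - _); field; rewrite gt_eqF.
by rewrite ln_div ?posrE ?expR_gt0 // lnV ?posrE // expRK opprK subrK.
Qed.

(** The point at time [t] lies between [z] and [y], and the slope decreases, so the sign of [y - z]
    makes both cases agree. The bound does not depend on [t]. *)
Lemma binary_entropy_slope_segment_ge z y t : 0 <= z <= 1 -> 0 < y < 1 -> 0 < t <= 1 ->
  (y - z) * binary_entropy_slope y <= (y - z) * binary_entropy_slope (z + t * (y - z)).
Proof.
move=> z01 y01 t01; have [zy|yz] := leP z y.
- by apply: ler_wpM2l; [lra|apply: binary_entropy_slope_decr; nra].
- by rewrite -subr_ge0 -mulrBr nmulr_rge0 ?subr_lt0 // subr_le0;
    apply: binary_entropy_slope_decr; nra.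
Qed.

Lemma binary_entropy_slope_unbounded0 y K : 0 < y < 1 ->
  exists2 t, 0 < t <= 1 & K < y * binary_entropy_slope (t * y).
Proof.
(* The term [K / y + 1] ensures that [y * L] exceeds [K]. *)
move=> /andP[y0 y1]; set L := Num.max (binary_entropy_slope y) (K / y + 1).
have e0 : 0 < 1 + expR L by rewrite addr_gt0 ?expR_gt0.
pose s := (1 + expR L)^-1.
have s0 : 0 < s by rewrite invr_gt0.
have s1 : s < 1 by rewrite invf_lt1 // ltrDl expR_gt0.
have sL : binary_entropy_slope s = L by exact: binary_entropy_slope_logistic.
(* Shrinking to [min s y] keeps [t <= 1], and the slope only grows. *)
pose u := Num.min s y.
have u0 : 0 < u by rewrite lt_min s0.
exists (u / y); first by rewrite divr_gt0 //= ler_pdivrMr // mul1r ge_min lexx orbT.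
rewrite divfK ?gt_eqF // mulrC -ltr_pdivrMr //.
apply: (@lt_le_trans _ _ L); first by rewrite lt_max [X in _ || X](_ : _ = true) ?orbT //; lra.
by rewrite -sL binary_entropy_slope_decr // ge_min lexx.
Qed.

Lemma binary_entropy_slope_unbounded z y K : z = 0 \/ z = 1 -> 0 < y < 1 ->
  exists2 t, 0 < t <= 1 & K < (y - z) * binary_entropy_slope (z + t * (y - z)).
Proof.
move=> [->|->] y01.
  have [t t01 Kt] := binary_entropy_slope_unbounded0 K y01.
  by exists t; rewrite // subr0 add0r.
(* The reflection [x -> 1 - x] negates both the slope and the direction, hence preserves their
   product. *)
have [|t t01 Kt] := @binary_entropy_slope_unbounded0 (1 - y) K; first by lra.
exists t => //; rewrite -(opprB 1 y) mulrN binary_entropy_slopeN.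
by rewrite mulrNN.
Qed.

End BinaryEntropy.

(** * First-order conditions at the maximum entropy matrix *)

Section MaximumEntropy.
Context {R : realType} {m n : nat}.
Variables (r : 'I_m -> nat) (c : 'I_n -> nat).
Implicit Types X Y Z D V : 'M[R]_(m, n).

(** The directions tangent to the affine space of matrices with given margins. *)
Let margins0 V := margins (fun _ : 'I_m => 0%N) (fun _ : 'I_n => 0%N) V.

Lemma entropyE X : entropy X = \sum_(p : 'I_m * 'I_n) binary_entropy (X p.1 p.2).
Proof. by rewrite /entropy pair_bigA. Qed.

Lemma margins_sub X Y : margins r c X -> margins r c Y -> margins0 (X - Y).
Proof.
move=> [Xr Xc] [Yr Yc]; split=> k; under eq_bigr do rewrite !mxE;
  by rewrite sumrB ?Xr ?Yr ?Xc ?Yc subrr.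
Qed.

Lemma margins_addZ t X V : margins r c X -> margins0 V -> margins r c (X + t *: V).
Proof.
move=> [Xr Xc] [Vr Vc]; split=> k; under eq_bigr do rewrite !mxE;
  by rewrite big_split -mulr_sumr /= ?Xr ?Vr ?Xc ?Vc mulr0 addr0.
Qed.

(** The slopes are taken at the moved point, since [Z] may still have entries 0 or 1. The tangent
    inequalities there bound [t] times the sum by the gain in entropy, which is at most 0. *)
Lemma max_entropy_slope_le0 Z V t : max_entropy_matrix r c Z -> margins0 V -> 0 < t ->
  (forall i j, 0 < Z i j + t * V i j < 1) ->
  \sum_(p : 'I_m * 'I_n)
     V p.1 p.2 * binary_entropy_slope (Z p.1 p.2 + t * V p.1 p.2) <= 0.
Proof.
move=> [[Zm Z01] Zmax] V0 t0 ZV01.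
have /Zmax : polytope r c (Z + t *: V).
  split; first exact: margins_addZ.
  by move=> i j; rewrite !mxE; have /andP[/ltW -> /ltW ->] := ZV01 i j.
rewrite -subr_le0 !entropyE -sumrB => le0.
rewrite -(pmulr_rle0 _ t0) mulr_sumr; apply: le_trans le0.
apply: ler_sum => p _; rewrite !mxE.
have := binary_entropy_tangent (ZV01 p.1 p.2) (Z01 p.1 p.2).
by rewrite addrAC subrr add0r mulrA.
Qed.

Lemma max_entropy_interior Z : max_entropy_matrix r c Z ->
  (exists2 Y : 'M[R]_(m, n), polytope r c Y & forall i j, 0 < Y i j < 1) ->
  forall i j, 0 < Z i j < 1.
Proof.
move=> Zmax [Y [Ym _] Y01] i j.
have [[Zm Z01] _] := Zmax.
apply: contrapT => /negP Zij.
have Zbd : Z i j = 0 \/ Z i j = 1.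
  move: Zij (Z01 i j); rewrite negb_and -!leNgt => /orP[] ? /andP[? ?];
    [left|right]; by apply/le_anti/andP.
pose V := Y - Z.
have VE k l : V k l = Y k l - Z k l by rewrite !mxE.
(* [K] bounds the contribution of the other entries from below for every [t] in []0, 1]], so [t] can
   be chosen after it. *)
pose K := \sum_(p : 'I_m * 'I_n | p != (i, j))
  V p.1 p.2 * binary_entropy_slope (Y p.1 p.2).
have [t t01 Kt] := binary_entropy_slope_unbounded (- K) Zbd (Y01 i j).
have /andP[t0 t1] := t01.
have in01 k l : 0 < Z k l + t * V k l < 1.
  by rewrite VE; move: (Y01 k l) (Z01 k l); nra.
have := max_entropy_slope_le0 Zmax (margins_sub Ym Zm) t0 in01.
apply/negP; rewrite -ltNge (bigD1 (i, j)) //= VE.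
rewrite -[ltLHS](addNr K) ltr_leD //; apply: ler_sum => p _.
by rewrite -/V VE binary_entropy_slope_segment_ge.
Qed.

(** Let [t] tend to 0 from the right in [max_entropy_slope_le0]: for small [t] the moved point stays
    interior, and the slope is continuous at interior entries. *)
Lemma max_entropy_slope_sum_le0 Z V : max_entropy_matrix r c Z ->
  (forall i j, 0 < Z i j < 1) -> margins0 V ->
  \sum_(p : 'I_m * 'I_n) V p.1 p.2 * binary_entropy_slope (Z p.1 p.2) <= 0.
Proof.
move=> Zmax Z01 V0.
pose f (p : 'I_m * 'I_n) t := Z p.1 p.2 + t * V p.1 p.2.
have f_cvg p : f p t @[t --> 0^'+] --> Z p.1 p.2.
  apply: cvg_at_right_filter.
  have <- : Z p.1 p.2 + 0 * V p.1 p.2 = Z p.1 p.2 by rewrite mul0r addr0.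
  by apply: cvgD; [exact: cvg_cst|apply: cvgM; [exact: cvg_id|exact: cvg_cst]].
have slope_cvg : \sum_p V p.1 p.2 * binary_entropy_slope (f p t) @[t --> 0^'+] -->
    \sum_p V p.1 p.2 * binary_entropy_slope (Z p.1 p.2).
  apply: cvg_big => [|p _]; first exact: add_continuous.
  have /andP[z0 z1] := Z01 p.1 p.2.
  apply: cvgM; first exact: cvg_cst.
  apply: cvgB.
    apply: continuous_cvg.
      by apply: continuous_ln; rewrite subr_gt0.
    by apply: cvgB => //; exact: cvg_cst.
  by apply: continuous_cvg => //; exact: continuous_ln.
have f01 : \forall t \near 0^'+, forall p, 0 < f p t < 1.
  apply: filter_forall => p; have /andP[z0 z1] := Z01 p.1 p.2.
  near=> t; apply/andP; split; near: t.
    exact: cvgr_gt (f_cvg p) _ z0.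
  exact: cvgr_lt (f_cvg p) _ z1.
apply: (cvgr_to_le slope_cvg); near=> t.
apply: max_entropy_slope_le0 => //.
near: t; apply: filterS f01 => t ft i j; exact: (ft (i, j)).
Unshelve. all: by end_near. Qed.

Lemma max_entropy_stationary Z V : max_entropy_matrix r c Z ->
  (forall i j, 0 < Z i j < 1) -> margins0 V ->
  \sum_(p : 'I_m * 'I_n) V p.1 p.2 * binary_entropy_slope (Z p.1 p.2) = 0.
Proof.
move=> Zmax Z01 V0; apply/le_anti/andP; split.
  exact: max_entropy_slope_sum_le0.
have VN : margins0 (- V).
  by case: V0 => Vr Vc; split=> k; under eq_bigr do rewrite mxE;
    rewrite sumrN ?Vr ?Vc oppr0.
have := max_entropy_slope_sum_le0 Zmax Z01 VN.
by under eq_bigr do rewrite mxE mulNr; rewrite sumrN oppr_le0.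
Qed.

Lemma max_entropy_bernoulli_prod Z D : max_entropy_matrix r c Z ->
  (forall i j, 0 < Z i j < 1) -> zero_one_matrices r c D ->
  \prod_(p : 'I_m * 'I_n) (if D p.1 p.2 == 1 then Z p.1 p.2 else 1 - Z p.1 p.2) =
  expR (- entropy Z).
Proof.
move=> Zmax Z01 [Dm D01]; have [[Zm _] _] := Zmax.
have st := max_entropy_stationary Zmax Z01 (margins_sub Dm Zm).
(* Subtracting the vanishing sum [st] in the exponent makes the identity hold factor by factor. *)
rewrite -[- entropy Z]subr0 -{1}st entropyE -sumrN -sumrB expR_sum.
apply: eq_bigr => p _; have z01 := Z01 p.1 p.2; have /andP[z0 z1] := z01.
rewrite binary_entropyE // !mxE /binary_entropy_slope.
have [->|->] := D01 p.1 p.2.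
  rewrite eq_sym oner_eq0 -[LHS]lnK ?posrE ?subr_gt0 //; congr expR; ring.
rewrite eqxx -[LHS]lnK ?posrE //; congr expR; ring.
Qed.

End MaximumEntropy.

(** * The law of the random matrix *)

Lemma matrix_pmf_bernoulli (R : realType) (m n : nat) (Z D : 'M[R]_(m, n))
    (d : measure_display) (T : measurableType d) (P : probability T R)
    (X : 'I_m -> 'I_n -> {RV P >-> R}) :
  mutually_independent (fun ij : 'I_m * 'I_n => X ij.1 ij.2) ->
  (forall i j, P [set w | X i j w = 1] = (Z i j)%:E) ->
  (forall i j, P [set w | X i j w = 0] = (1 - Z i j)%:E) ->
  (forall i j, D i j = 0 \/ D i j = 1) ->
  matrix_pmf X D = (\prod_(p : 'I_m * 'I_n)
    (if D p.1 p.2 == 1 then Z p.1 p.2 else 1 - Z p.1 p.2))%:E.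
Proof.
move=> indep X1 X0 D01.
(* The event that the matrix equals [D] is the intersection over all entries of the preimages of
   singletons. *)
have := indep [set: 'I_m * 'I_n]%SET (fun p => [set D p.1 p.2]) (fun _ _ => measurable_set1 _).
rewrite -prodEFin /matrix_pmf.
rewrite [X in P X = _ -> _](_ : _ = [set w | random_matrix X w = D]); last first.
  apply/seteqP; split=> w /=.
    move=> h; apply/matrixP => i j; rewrite mxE.
    by apply: (h (i, j)); rewrite /= inE.
  by move=> <- p _ /=; rewrite mxE.
move=> ->; apply: eq_big => [p|p _]; first by rewrite inE.
by have [->|->] := D01 p.1 p.2; rewrite ?eqxx ?X1 // eq_sym oner_eq0 X0.
Qed.

Theorem theorem1p5 (R : realType) (m n : nat) (r : 'I_m -> nat) (c : 'I_n -> nat)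
    (hsum : (\sum_(i < m) r i = \sum_(j < n) c j)%N)
    (hr : forall i, (0 < r i < n)%N)
    (hc : forall j, (0 < c j < m)%N)
    (hint : exists2 Y : 'M[R]_(m, n), polytope r c Y & forall i j, 0 < Y i j < 1)
    (Z : 'M[R]_(m, n)) (hZ : max_entropy_matrix r c Z)
    (d : measure_display) (T : measurableType d) (P : probability T R)
    (X : 'I_m -> 'I_n -> {RV P >-> R})
    (hindep : mutually_independent (fun ij : 'I_m * 'I_n => X ij.1 ij.2))
    (hX1 : forall i j, P [set w | X i j w = 1] = (Z i j)%:E)
    (hX0 : forall i j, P [set w | X i j w = 0] = (1 - Z i j)%:E) :
  (forall D D' : 'M[R]_(m, n), zero_one_matrices r c D -> zero_one_matrices r c D' ->
     matrix_pmf X D = matrix_pmf X D') /\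
  (forall D : 'M[R]_(m, n), zero_one_matrices r c D ->
     matrix_pmf X D = (expR (- entropy Z))%:E).
Proof.
have pmfE D : zero_one_matrices r c D -> matrix_pmf X D = (expR (- entropy Z))%:E.
  move=> Dz; rewrite (matrix_pmf_bernoulli hindep hX1 hX0 Dz.2).
  by rewrite (max_entropy_bernoulli_prod hZ (max_entropy_interior hZ hint) Dz).
by split=> // D D' /pmfE -> /pmfE ->.
Qed.
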